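(* Let $0<\lambda<\mu$, and let $A$ and $S$ be independent homogeneous Poisson processes with respective intensities $\lambda$ and $\mu$, with counting functions $A(t)$, $S(t)$, $t\ge 0$. Then the conditional law of $\{(A(t),S(t)),\ t\ge 0\}$ given that $A(t)\le S(t)$ for all $t\ge 0$ is the same as the unconditional law of $\{\Gamma_2(A,S)(t),\ t\ge 0\}$.
   Context: For a Poisson process $X$, $X(t)$ denotes the number of points of $X$ in $(0,t]$, with $X(0)=0$. Let $D_0(\mathbb{R}_+)$ be the space of cadlag paths $f:\mathbb{R}_+\to\mathbb{R}$ with $f(0)=0$. For $f,g\in D_0(\mathbb{R}_+)$ define $f\otimes g,\ f\odot g\in D_0(\mathbb{R}_+)$ by $$(f\otimes g)(t)=\inf_{0\le s\le t}[f(s)+g(t)-g(s)],\qquad (f\odot g)(t)=\sup_{0\le s\le t}[f(s)+g(t)-g(s)],$$ and define $\Gamma_2:D_0(\mathbb{R}_+)^2\to D_0(\mathbb{R}_+)^2$ by $\Gamma_2(f,g)=(f\otimes g,\ g\odot f)$. *)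

(* Defs.v *)
From HB Require Import structures.
From mathcomp Require Import all_boot all_order all_algebra.
From mathcomp Require Import all_classical all_reals all_analysis.
From mathcomp Require Import measurable_realfun.

Set Implicit Arguments.
Unset Strict Implicit.
Unset Printing Implicit Defensive.

Import Order.TTheory GRing.Theory Num.Theory.
Import numFieldNormedType.Exports.

Local Open Scope classical_set_scope.
Local Open Scope ring_scope.

Definition cadlag (R : realType) (f : R -> R) : Prop :=
  right_continuous f /\ forall t : R, cvg (f x @[x --> t^'-]).

(* A path on [0, +oo[ null at 0 is represented by its extension by 0 to the
   whole line; restriction to [0, +oo[ is a bijection from [D0 R] to the
   cadlag paths on [0, +oo[ that are null at 0. *)
Record D0 (R : realType) := MkD0 {
  path :> R -> R ;
  path_le0 : forall t, t <= 0 -> path t = 0 ;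
  path_cadlag : cadlag path }.

Section D0_measurable.
Context (R : realType).

Lemma D0_eq (f g : D0 R) : path f =1 path g -> f = g.
Proof.
case: f => f f0 fc; case: g => g g0 gc /= /funext fg.
move: f0 fc g0 gc; rewrite fg => f0 fc g0 gc.
by rewrite (Prop_irrelevance f0 g0) (Prop_irrelevance fc gc).
Qed.

Lemma cadlag_cst0 : cadlag (cst 0 : R -> R).
Proof. by split=> t; [exact: cvg_cst|exact: is_cvg_cst]. Qed.

HB.instance Definition _ := gen_eqMixin (D0 R).
HB.instance Definition _ := gen_choiceMixin (D0 R).
HB.instance Definition _ := isPointed.Build (D0 R)
  (@MkD0 R (cst 0) (fun _ _ => erefl) cadlag_cst0).

Definition cylinder : set (set (D0 R)) :=
  [set C | exists t : R, exists2 B : set R,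
    measurable B & C = [set f : D0 R | B (f t)]].

(* The sigma-algebra generated by the evaluations (which is also the Borel
   sigma-algebra of the Skorokhod topology). *)
HB.instance Definition _ := @isMeasurable.Build (sigma_display cylinder)
  (D0 R) <<s cylinder >> (@sigma_algebra0 _ setT cylinder)
  (@sigma_algebraC _ cylinder) (@sigma_algebra_bigcup _ setT cylinder).

Lemma measurable_eval (t : R) : measurable_fun setT (fun f : D0 R => f t).
Proof.
move=> _ B mB; rewrite setTI; apply: sub_sigma_algebra.
by exists t, B.
Qed.

Lemma measurable_fun_D0 d (T : measurableType d) (X : T -> D0 R) :
  (forall t : R, measurable_fun setT (fun w => X w t)) ->
  measurable_fun setT X.
Proof.
move=> mX; apply: (@measurability _ _ _ _ _ _ cylinder) => //.
move=> _ [_ [t [B mB ->]] <-].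
by have := mX t measurableT _ mB.
Qed.

End D0_measurable.

Section cadlag_theory.
Context (R : realType).
Implicit Types (f g h : R -> R) (t : R).

Lemma cadlagN f : cadlag f -> cadlag (fun t => - f t).
Proof.
move=> [rf lf]; split=> t; first by apply: cvgN; exact: rf.
by apply: is_cvgN; exact: lf.
Qed.

Lemma cadlagD f g : cadlag f -> cadlag g -> cadlag (fun t => f t + g t).
Proof.
move=> [rf lf] [rg lg]; split=> t; first by apply: cvgD; [exact: rf|exact: rg].
by apply: is_cvgD; [exact: lf|exact: lg].
Qed.

Lemma cadlag_bounded h (t : R) : cadlag h ->
  exists M : R, forall s, `[0, t]%classic s -> `|h s| <= M.
Proof.
move=> [rh lh].
have /compact_near_coveringP cpt := @segment_compact R 0 t.
have := cpt R +oo (fun (M : R) (s : R) => `|h s| <= M) _.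
case=> [x _|M [_ /(_ (M + 1))]]; last first.
  by rewrite ltrDl ltr01 => /(_ isT) bM; exists (M + 1).
have /cvg_ex[l hl] := lh x.
have lN : \forall y \near x^'-, `|l - h y| < 1.
  by move/cvgrPdist_lt : hl => /(_ 1 ltr01).
have rN : \forall y \near x^'+, `|h x - h y| < 1.
  by have /cvgrPdist_lt/(_ 1 ltr01) := rh x.
set M := Num.max (`|l| + 1) (`|h x| + 1).
have nM : \forall y \near x, `|h y| <= M.
  have {}lN : \forall y \near x, y < x -> `|l - h y| < 1 by exact: lN.
  have {}rN : \forall y \near x, x < y -> `|h x - h y| < 1 by exact: rN.
  near=> y; have [yx|xy|->] := ltgtP y x.
  - have : `|l - h y| < 1 by move: yx; near: y.
    rewrite le_max => /ltW ly; apply/orP; left.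
    rewrite -(subrKC l (h y)) (le_trans (ler_normD _ _))// lerD2l.
    by rewrite distrC.
  - have : `|h x - h y| < 1 by move: xy; near: y.
    rewrite le_max => /ltW ly; apply/orP; right.
    rewrite -(subrKC (h x) (h y)) (le_trans (ler_normD _ _))// lerD2l.
    by rewrite distrC.
  - by rewrite le_max lerDl ler01 orbT.
near=> y N => /=.
apply: (@le_trans _ _ M); first by near: y.
by near: N; apply: nbhs_pinfty_ge; rewrite num_real.
Unshelve. all: by end_near. Qed.

Definition runinf h t : R := inf [set h s | s in `[0, t]].

Lemma has_lbound_runinf h t : cadlag h -> has_lbound [set h s | s in `[0, t]].
Proof.
move=> /(cadlag_bounded t)[M hM]; exists (- M) => _ [s st <-].
by have := hM s st; rewrite ler_norml => /andP[].
Qed.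

Lemma runinf_le h t s : cadlag h -> 0 <= s <= t -> runinf h t <= h s.
Proof.
move=> ch st; apply: ge_inf; first exact: has_lbound_runinf.
by exists s => //=; rewrite in_itv.
Qed.

Lemma le_runinf h t c : 0 <= t -> (forall s, 0 <= s <= t -> c <= h s) ->
  c <= runinf h t.
Proof.
move=> t0 ch; apply: lb_le_inf.
  by exists (h 0), 0 => //=; rewrite in_itv/= lexx.
by move=> _ [s /= + <-]; rewrite in_itv/=; exact: ch.
Qed.

Lemma runinf_lt0 h t : t < 0 -> runinf h t = 0.
Proof.
move=> t0; rewrite /runinf set_itv_ge ?image_set0 ?inf0//.
by rewrite bnd_simp -ltNge.
Qed.

Lemma runinf0 h : runinf h 0 = h 0.
Proof. by rewrite /runinf set_itv1 image_set1 inf1. Qed.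

Lemma runinf_nonincreasing h s t : cadlag h -> 0 <= s -> s <= t ->
  runinf h t <= runinf h s.
Proof.
move=> ch s0 st; apply: le_runinf => // u /andP[u0 us].
by apply: runinf_le => //; rewrite u0 (le_trans us).
Qed.

Lemma cadlag_right h t e : cadlag h -> 0 < e ->
  exists2 d : R, 0 < d & forall y, t <= y -> y < t + d -> `|h t - h y| < e.
Proof.
move=> [rh _] e0; have /cvgrPdist_lt/(_ e e0) := rh t.
rewrite near_withinE => /nbhs_ballP[d /= d0 hd]; exists d => // y.
rewrite le_eqVlt => /predU1P[<-|ty] ytd; first by rewrite subrr normr0.
by apply: hd => //; rewrite /ball/= ltr0_norm ?subr_lt0// opprB ltrBlDl.
Qed.

Lemma cadlag_runinf h : cadlag h -> cadlag (runinf h).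
Proof.
move=> ch; split=> t.
- have [t0|t0] := ltP t 0.
    rewrite runinf_lt0//; apply: cvg_near_cst.
    near=> u; apply: runinf_lt0.
    by near: u; exact: nbhs_right_lt.
  apply/cvgrPdist_le => e e0.
  have [d d0 hd] := cadlag_right t ch e0.
  near=> u.
  have tu : t <= u by near: u; exact: nbhs_right_ge.
  have utd : u < t + d by near: u; apply: nbhs_right_lt; rewrite ltrDl.
  rewrite ger0_norm ?subr_ge0; last exact: runinf_nonincreasing.
  rewrite lerBlDr -lerBlDl; apply: le_runinf; first exact: le_trans tu.
  move=> s /andP[s0 su]; have [st|ts] := leP s t.
    rewrite lerBlDl (@le_trans _ _ (h s))//; first exact/runinf_le/andP.
    by rewrite lerDr ltW.
  have := hd s (ltW ts) (le_lt_trans su utd).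
  move=> /ltr_distlBl /ltW hs; apply: le_trans hs.
  rewrite lerB//; apply: runinf_le => //.
  by rewrite t0/=.
- have [t0|t0] := leP t 0.
    apply: (cvgP 0); apply: cvg_near_cst.
    near=> u; apply: runinf_lt0.
    by apply: lt_le_trans t0; near: u; exact: nbhs_left_lt.
  suff : cvg ((fun u => - runinf h u) x @[x --> t^'-]).
    by move/is_cvgN; under eq_fun do rewrite opprK.
  apply: nondecreasing_at_left_is_cvgr.
    near=> x => u v; rewrite !in_itv/= => /andP[xu _] _ uv.
    rewrite lerN2; apply: runinf_nonincreasing => //.
    rewrite (le_trans _ (ltW xu))//.
    by near: x; exact: nbhs_left_ge.
  near=> x; exists (- runinf h t) => _ [u /= + <-].
  rewrite in_itv/= => /andP[xu ut]; rewrite lerN2.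
  apply: runinf_nonincreasing => //; last exact: ltW.
  rewrite (le_trans _ (ltW xu))//.
  by near: x; exact: nbhs_left_ge.
Unshelve. all: by end_near. Qed.

End cadlag_theory.

Section convolutions.
Context (R : realType).
Implicit Types (f g : R -> R) (t : R).

(* For t < 0 the index set is empty, and [inf set0 = sup set0 = 0]: both
   operations commute with the extension of paths by 0. *)
Definition minconv f g t : R := inf [set f s + g t - g s | s in `[0, t]].

Definition maxconv f g t : R := sup [set f s + g t - g s | s in `[0, t]].

Lemma minconvE f g t : cadlag f -> cadlag g -> 0 <= t ->
  minconv f g t = runinf (fun s => f s - g s) t + g t.
Proof.
move=> cf cg t0.
have ch : cadlag (fun s => f s - g s) by apply: cadlagD => //; exact: cadlagN.
apply/eqP; rewrite eq_le; apply/andP; split.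
  rewrite -lerBlDr; apply: le_runinf => // s st; rewrite lerBlDr addrAC.
  apply: ge_inf; last by exists s => //=; rewrite in_itv.
  exists (runinf (fun s => f s - g s) t + g t) => _ [u /= ut <-].
  rewrite addrAC lerD2r; exact: runinf_le.
apply: lb_le_inf.
  by exists (f 0 + g t - g 0), 0 => //=; rewrite in_itv/= lexx.
move=> _ [u /= ut <-]; rewrite addrAC lerD2r; exact: runinf_le.
Qed.

Lemma maxconvN f g t :
  maxconv f g t = - minconv (fun s => - f s) (fun s => - g s) t.
Proof.
rewrite /maxconv /minconv /inf opprK; congr sup.
apply/seteqP; split=> [_ [s st <-]|_ [_ [s st <-] <-]].
  exists (- f s + - g t - - g s); first by exists s.
  by rewrite !opprD !opprK.
by exists s => //; rewrite !opprD !opprK.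
Qed.

Lemma minconv_le0 f g t : f 0 = 0 -> (forall s, s <= 0 -> g s = 0) ->
  t <= 0 -> minconv f g t = 0.
Proof.
move=> f0 g0; rewrite le_eqVlt => /predU1P[->|t0].
  by rewrite /minconv set_itv1 image_set1 inf1 f0 add0r subrr.
by rewrite /minconv set_itv_ge ?image_set0 ?inf0// bnd_simp -ltNge.
Qed.

Lemma minconv_cadlag f g : f 0 = 0 -> (forall s, s <= 0 -> g s = 0) ->
  cadlag f -> cadlag g -> cadlag (minconv f g).
Proof.
move=> f0 g0 cf cg.
have ch : cadlag (fun s => f s - g s) by apply: cadlagD => //; exact: cadlagN.
rewrite (_ : minconv f g = fun t => runinf (fun s => f s - g s) t + g t).
  by apply: cadlagD => //; exact: cadlag_runinf.
apply/funext => t; have [t0|t0] := leP 0 t; first exact: minconvE.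
by rewrite minconv_le0 ?runinf_lt0 ?g0 ?addr0// ltW.
Qed.

Lemma maxconv_le0 f g t : f 0 = 0 -> (forall s, s <= 0 -> g s = 0) ->
  t <= 0 -> maxconv f g t = 0.
Proof.
move=> f0 g0 t0; rewrite maxconvN minconv_le0 ?oppr0//; first by rewrite f0 oppr0.
by move=> s s0; rewrite g0 ?oppr0.
Qed.

Lemma maxconv_cadlag f g : f 0 = 0 -> (forall s, s <= 0 -> g s = 0) ->
  cadlag f -> cadlag g -> cadlag (maxconv f g).
Proof.
move=> f0 g0 cf cg; rewrite (funext (maxconvN f g)).
apply/cadlagN/minconv_cadlag.
- by rewrite f0 oppr0.
- by move=> s s0; rewrite g0 ?oppr0.
- exact: cadlagN.
- exact: cadlagN.
Qed.

Definition D0_minconv (f g : D0 R) : D0 R :=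
  MkD0 (fun t => minconv_le0 (path_le0 f (lexx 0)) (@path_le0 R g))
       (minconv_cadlag (path_le0 f (lexx 0)) (@path_le0 R g)
                       (path_cadlag f) (path_cadlag g)).

Definition D0_maxconv (f g : D0 R) : D0 R :=
  MkD0 (fun t => maxconv_le0 (path_le0 f (lexx 0)) (@path_le0 R g))
       (maxconv_cadlag (path_le0 f (lexx 0)) (@path_le0 R g)
                       (path_cadlag f) (path_cadlag g)).

Definition Gamma2 (fg : D0 R * D0 R) : D0 R * D0 R :=
  (D0_minconv fg.1 fg.2, D0_maxconv fg.2 fg.1).

Definition ordered_paths : set (D0 R * D0 R) :=
  [set fg : D0 R * D0 R | forall t : R, 0 <= t -> fg.1 t <= fg.2 t].

End convolutions.

Section measurability_lemmas.
Context (R : realType).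

(* A sequence dense in [[0, t]] that contains t when 0 <= t. *)
Let clamp (t : R) (n : nat) : R :=
  Num.min (Num.max 0 (ratr (odflt 0 (unpickle n)))) t.

Let clamp_itv t n : 0 <= t -> 0 <= clamp t n <= t.
Proof.
by move=> t0; rewrite /clamp le_min le_max lexx t0 /= ge_min lexx orbT.
Qed.

Let clamp_dense t s e : 0 <= s -> s <= t -> 0 < e ->
  exists n, s <= clamp t n < s + e.
Proof.
move=> s0 st e0.
have /rat_in_itvoo[q /itvP qe] : s < s + e by rewrite ltrDl.
exists (pickle q); rewrite /clamp pickleK/= le_min st andbT gt_min.
by rewrite le_max gt_max qe orbT/= (le_lt_trans s0) ?ltrDl// qe.
Qed.

Lemma runinf_clamp (h : R -> R) t : cadlag h -> 0 <= t ->
  runinf h t = infs (h \o clamp t) 0.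
Proof.
move=> ch t0; apply/eqP; rewrite eq_le; apply/andP; split.
  apply: lb_le_inf; first by exists (h (clamp t 0)), 0%N.
  by move=> _ [n _ <-]; apply: runinf_le => //; exact: clamp_itv.
apply: le_runinf => // s /andP[s0 st]; apply/ler_addgt0Pr => e e0.
have [d d0 hd] := cadlag_right s ch e0.
have [n /andP[sn nd]] := clamp_dense s0 st d0.
apply: (@le_trans _ _ (h (clamp t n))).
  apply: ge_inf; last by exists n.
  exists (runinf h t) => _ [m _ <-]; apply: runinf_le => //.
  exact: clamp_itv.
by have /ltr_distlCDr/ltW := hd _ sn nd.
Qed.

Lemma measurable_runinf d (T : measurableType d) (h : T -> R -> R) (t : R) :
  (forall w, cadlag (h w)) ->
  (forall s, measurable_fun setT (fun w => h w s)) ->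
  measurable_fun setT (fun w => runinf (h w) t).
Proof.
move=> ch mh; have [t0|t0] := leP 0 t; last first.
  by under eq_fun do rewrite runinf_lt0//; exact: measurable_cst.
under eq_fun do rewrite runinf_clamp//.
apply: (@measurable_fun_infs _ _ _ setT (fun n w => h w (clamp t n)) 0) => //.
move=> w _; exists (runinf (h w) t) => _ [m _ <-]; apply: runinf_le => //.
exact: clamp_itv.
Qed.

Lemma measurable_minconv d (T : measurableType d) (f g : T -> R -> R) (t : R) :
  (forall w, cadlag (f w)) -> (forall w, cadlag (g w)) ->
  (forall s, measurable_fun setT (fun w => f w s)) ->
  (forall s, measurable_fun setT (fun w => g w s)) ->
  measurable_fun setT (fun w => minconv (f w) (g w) t).
Proof.
move=> cf cg mf mg; have [t0|t0] := leP 0 t; last first.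
  rewrite /minconv; under eq_fun do
    rewrite set_itv_ge ?image_set0 ?inf0// ?bnd_simp -?ltNge//.
  exact: measurable_cst.
under eq_fun do rewrite minconvE//.
apply: measurable_funD => //; apply: measurable_runinf => [w|s].
  by apply: cadlagD => //; exact: cadlagN.
exact: measurable_funB.
Qed.

Let eval1 s : measurable_fun setT (fun fg : D0 R * D0 R => fg.1 s).
Proof.
exact: (measurableT_comp (measurable_eval s) measurable_fst).
Qed.

Let eval2 s : measurable_fun setT (fun fg : D0 R * D0 R => fg.2 s).
Proof.
exact: (measurableT_comp (measurable_eval s) measurable_snd).
Qed.

Lemma measurable_Gamma2 : measurable_fun setT (@Gamma2 R).
Proof.
apply: measurable_fun_pair; apply: measurable_fun_D0 => t.
  by apply: measurable_minconv => // -[f g]; exact: path_cadlag.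
rewrite [X in measurable_fun _ X](_ : _ =
    (fun fg : D0 R * D0 R =>
       - minconv (fun s => - fg.2 s) (fun s => - fg.1 s) t)); last first.
  by apply/funext => -[f g]; exact: maxconvN.
apply/measurable_funN/measurable_minconv => [[f g]|[f g]|s|s].
- exact/cadlagN/path_cadlag.
- exact/cadlagN/path_cadlag.
- exact: measurable_funN.
- exact: measurable_funN.
Qed.

Lemma measurable_ordered_paths : measurable (@ordered_paths R).
Proof.
pose q (n : nat) : R := Num.max 0 (ratr (odflt 0 (unpickle n))).
rewrite (_ : @ordered_paths R =
    \bigcap_n [set fg : D0 R * D0 R | fg.1 (q n) <= fg.2 (q n)]).
  apply: bigcapT_measurable => n.
  rewrite -[X in measurable X]setTI.
  have /(_ measurableT [set true]) := measurable_fun_ler (eval1 (q n)) (eval2 (q n)).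
  exact.
apply/seteqP; split=> [fg fgP n _|fg fgP t t0] /=.
  by apply: fgP; rewrite le_max lexx.
rewrite leNgt; apply/negP => gf.
have ch : cadlag (fun s => fg.1 s - fg.2 s).
  apply: cadlagD; first exact: path_cadlag.
  exact/cadlagN/path_cadlag.
have := gf; rewrite -subr_gt0 => gf0.
have [d d0 hd] := cadlag_right t ch gf0.
have /rat_in_itvoo[r /itvP re] : t < t + d by rewrite ltrDl.
have qr : q (pickle r) = ratr r.
  by rewrite /q pickleK/= max_r// (le_trans t0)// re.
have := hd (ratr r); rewrite !re => /(_ isT isT) /ltr_distlBl.
rewrite subrr subr_gt0 ltNge -qr; apply/negP/negPn.
exact: fgP.
Qed.

End measurability_lemmas.

HB.instance Definition _ (R : realType) :=
  isMeasurableFun.Build _ _ _ _ (@Gamma2 R) (@measurable_Gamma2 R).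

Section processes.
Context d (T : measurableType d) (R : realType) (P : probability T R).
Local Open Scope ereal_scope.

Definition joint (X Y : {RV P >-> D0 R}) (w : T) : D0 R * D0 R := (X w, Y w).

Lemma measurable_joint (X Y : {RV P >-> D0 R}) :
  measurable_fun setT (joint X Y).
Proof. exact: measurable_fun_pair. Qed.

HB.instance Definition _ (X Y : {RV P >-> D0 R}) :=
  isMeasurableFun.Build _ _ _ _ (joint X Y) (measurable_joint X Y).

Definition independent_RV2 (X Y : {RV P >-> D0 R}) : Prop :=
  forall B C : set (D0 R), measurable B -> measurable C ->
    P (X @^-1` B `&` Y @^-1` C) = P (X @^-1` B) * P (Y @^-1` C).

Definition independent_family n (Y : 'I_n -> T -> R) : Prop :=
  forall B : 'I_n -> set R, (forall i, measurable (B i)) ->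
    P (\bigcap_(i in [set: 'I_n]) (Y i @^-1` B i)) =
    \prod_(i < n) P (Y i @^-1` B i).

(* [f t] is the number of points in ]0, t] of a locally finite configuration
   of points of ]0, +oo[, counted with multiplicity. *)
Definition counting_path (f : D0 R) : Prop :=
  {homo f : s t / (s <= t)%R} /\ forall t, exists n : nat, f t = n%:R.

Definition increment (X : {RV P >-> D0 R}) (s t : R) (w : T) : R :=
  (X w t - X w s)%R.

Record poisson_process (lambda : R) (X : {RV P >-> D0 R}) : Prop := {
  poisson_counting : forall w, counting_path (X w) ;
  poisson_increment : forall (s t : R) (k : nat), (0 <= s)%R -> (s < t)%R ->
    P [set w | increment X s t w = k%:R] =
    (poisson_pmf (lambda * (t - s)) k)%:E ;
  poisson_independent : forall (n : nat) (t : nat -> R), (0 <= t 0%N)%R ->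
    {homo t : i j / (i <= j)%N >-> (i <= j)%R} ->
    independent_family (fun i : 'I_n => increment X (t i) (t i.+1)) }.

(* Elementary conditional probability, meaningful when [P E] is nonzero. *)
Definition cond_prob (E F : set T) : \bar R :=
  P (F `&` E) * ((fine (P E))^-1)%:E.

Definition cond_distribution (E : set T) d' (U : measurableType d')
    (X : {RV P >-> U}) : set U -> \bar R :=
  pushforward (cond_prob E) X.

Lemma measurable_ordered_event (A S : {RV P >-> D0 R}) :
  measurable [set w | forall t : R, (0 <= t)%R -> (A w t <= S w t)%R].
Proof.
have := measurable_joint A S measurableT (@measurable_ordered_paths R).
by rewrite setTI.
Qed.

End processes.

Arguments independent_RV2 {d T R} P X Y.
Arguments independent_family {d T R} P {n} Y.
Arguments poisson_process {d T R} P lambda X.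
Arguments cond_prob {d T R} P E F.
Arguments cond_distribution {d T R} P E {d' U} X.

(* Main.v *)
Require Import Defs.
From HB Require Import structures.
From mathcomp Require Import all_boot all_order all_algebra.
From mathcomp Require Import all_classical all_reals all_analysis.
From mathcomp Require Import measurable_realfun.
From mathcomp Require Import ring lra.

(** Put [rho = lambda / mu] and read [A] as arrivals
    and [S] as offered services of a queue: [Gamma2 (A, S)] then consists of
    the departures, and of the arrivals increased by the unused services.

    Cut [0, N h] into [N] cells of length [h].  When no cell contains two
    jumps, [(A, S)] is described on the grid by a word over {no jump, arrival,
    service}, each word having the product of its letter probabilities, and
    [Gamma2] acts on words as the map [pitman] ([Gamma2_follows]): within a
    cell one of the two paths is constant, so that [A - S] is monotone there
    and its running infimum is attained on the grid.  The map [pitman] keeps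
    the positions of the jumps and only relabels them.  With
    [p arrival = rho * p service], the law of the image word is explicit: the
    word [x], whose last value of services minus arrivals is [D], has
    probability [p(x) (1 + rho + ... + rho^D)] if its arrivals never outnumber
    its services, and [0] otherwise ([word_sum_pitman]).  This is the discrete
    2M - X theorem of Pitman.  Therefore, on words,
      (1 - rho) P(Gamma2 in C) = P(C, ordered) - E[C, ordered; rho^(D+1)].

    The proof then takes a limit along the grids with [8^n] cells of length
    [4^-n], which are nested, become dense and exhaust the half-line.  Two
    jumps share a cell with probability O(8^n 16^-n) = O(2^-n).  The
    correction term is at most the expectation of sqrt(rho)^D over all words,
    which is bounded by exp(-(sqrt mu - sqrt lambda)^2 2^n).  Events that
    depend on the values on one grid thus satisfy (1 - rho) P(Gamma2 in C) = P(C, A <= S forever)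
    ([grid_event_identity]); they form a pi-system generating the product
    sigma-algebra because paths are right-continuous, so the identity extends
    to every measurable [C] ([event_identity]).  Taking [C] to be everything
    gives P(A <= S forever) = 1 - rho > 0, and dividing yields the claim. *)

Set Implicit Arguments.
Unset Strict Implicit.
Unset Printing Implicit Defensive.

Import Order.TTheory GRing.Theory Num.Theory.
Import numFieldNormedType.Exports.

Local Open Scope classical_set_scope.
Local Open Scope ring_scope.

(** * Discrete Pitman transform of words *)

(** The jump content of one cell: [None] stands for no jump. *)
Notation letter := (option bool).
Notation arrival := (Some false).
Notation service := (Some true).

Section word_sums.
Context {R : realType} (p : letter -> R).
Implicit Types (n : nat) (F G : seq letter -> R).

(** The expectation of [F] for a word of [n] independent letters when [p] is a
    probability. *)
Definition word_sum n F : R :=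
  \sum_(x : n.-tuple letter) (\prod_(a <- x) p a) * F x.

Lemma word_sum0 F : word_sum 0 F = F [::].
Proof.
rewrite /word_sum (big_pred1 [tuple]) ?big_nil ?mul1r// => x.
by apply/esym/eqP; exact: tuple0.
Qed.

Lemma word_sumS n F : word_sum n.+1 F =
  p None * word_sum n (F \o cons None) +
  p arrival * word_sum n (F \o cons arrival) +
  p service * word_sum n (F \o cons service).
Proof.
have -> : word_sum n.+1 F =
    \sum_(a : letter) p a * word_sum n (F \o cons a).
  under [RHS]eq_bigr do rewrite /word_sum mulr_sumr.
  rewrite pair_bigA/= /word_sum.
  rewrite (reindex (fun z : letter * n.-tuple letter => cons_tuple z.1 z.2))/=.
    by apply: eq_bigr => -[a x] _ /=; rewrite big_cons mulrA.
  exists (fun x : n.+1.-tuple letter => (thead x, behead_tuple x)).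
    by case=> a x _; congr pair; apply: val_inj.
  by move=> x _; rewrite [RHS]tuple_eta; apply: val_inj.
rewrite (bigD1 None)//= (bigD1 arrival)//= (bigD1 service)//=.
by rewrite big1 ?addr0 ?addrA// => -[[]|].
Qed.

Lemma eq_word_sum n F G : (forall x : n.-tuple letter, F x = G x) ->
  word_sum n F = word_sum n G.
Proof. by move=> FG; apply: eq_bigr => x _; rewrite FG. Qed.

Lemma word_sumD n F G :
  word_sum n (fun x => F x + G x) = word_sum n F + word_sum n G.
Proof. by rewrite -big_split; apply: eq_bigr => x _; rewrite /= mulrDr. Qed.

Lemma word_sumZ n c F : word_sum n (fun x => c * F x) = c * word_sum n F.
Proof. by rewrite mulr_sumr; apply: eq_bigr => x _; rewrite mulrCA. Qed.

Lemma word_sumB n F G :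
  word_sum n (fun x => F x - G x) = word_sum n F - word_sum n G.
Proof.
rewrite -[- word_sum n G]mulN1r -word_sumZ -word_sumD.
by apply: eq_word_sum => x; rewrite mulN1r.
Qed.

Lemma word_sum_cst0 n : word_sum n (fun=> 0) = 0.
Proof. by rewrite /word_sum big1// => x _; rewrite mulr0. Qed.

Lemma word_sum1 n : word_sum n (fun=> 1) = (p None + p arrival + p service) ^+ n.
Proof.
elim: n => [|n IH]; first by rewrite word_sum0.
by rewrite word_sumS /comp IH exprS !mulrDl.
Qed.

Lemma word_sum_ge0 n F : (forall a, 0 <= p a) -> (forall x, 0 <= F x) ->
  0 <= word_sum n F.
Proof.
by move=> p0 F0; apply: sumr_ge0 => x _; apply: mulr_ge0 => //; apply: prodr_ge0.
Qed.

Lemma ler_word_sum n F G : (forall a, 0 <= p a) -> (forall x, F x <= G x) ->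
  word_sum n F <= word_sum n G.
Proof.
move=> p0 FG; rewrite -subr_ge0 -word_sumB; apply: word_sum_ge0 => // x.
by rewrite subr_ge0.
Qed.

End word_sums.

(** The argument [k] is the queue length, that is, the running maximum of
    services minus arrivals, minus its current value.  An arrival is sent to a
    service.  A service is sent to an arrival when it serves someone, and is
    unused, hence kept, when the queue is empty. *)
Fixpoint pitman (k : nat) (x : seq letter) : seq letter :=
  match x with
  | [::] => [::]
  | None :: y => None :: pitman k y
  | arrival :: y => service :: pitman k.+1 y
  | service :: y =>
      if k is j.+1 then arrival :: pitman j y else service :: pitman 0 y
  end.

(** Here [d] is the current excess of services over arrivals. *)
Fixpoint nonneg_from (d : nat) (x : seq letter) : bool :=
  match x with
  | [::] => true
  | None :: y => nonneg_from d y
  | arrival :: y => (0 < d)%N && nonneg_from d.-1 y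
  | service :: y => nonneg_from d.+1 y
  end.

(** The predecessor is truncated at 0, so this is the final excess of services
    over arrivals only for words that satisfy [nonneg_from d]. *)
Fixpoint level (d : nat) (x : seq letter) : nat :=
  match x with
  | [::] => d
  | None :: y => level d y
  | arrival :: y => level d.-1 y
  | service :: y => level d.+1 y
  end.

Section discrete_pitman.
Context {R : realType} (p : letter -> R) (rho : R).
Hypothesis p_arrival : p arrival = rho * p service.

(** Intertwining: if the initial queue length has weight [rho ^ k] on
    [0 .. d], then after each letter, given the image letters so far, it has
    weight [rho ^ k] on [0 .. d'] for the new excess [d'] of the image word, the
    image letters having their own weights [p].  Indeed an image service comes
    from an arrival, which shifts [k] to [k + 1] with weight
    [p arrival = rho * p service], or from an unused service, which supplies
    the missing value [k = 0]; an image arrival comes from a service with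
    [k > 0], which is impossible when [d = 0]. *)
Lemma word_sum_pitman n d (F : seq letter -> R) :
  \sum_(k < d.+1) rho ^+ k * word_sum p n (F \o pitman k) =
  word_sum p n (fun x => (nonneg_from d x)%:R *
    (F x * \sum_(k < (level d x).+1) rho ^+ k)).
Proof.
elim: n d F => [|n IH] d F.
  under eq_bigr do rewrite word_sum0.
  by rewrite word_sum0 /= mul1r mulr_sumr; apply: eq_bigr => i _; rewrite mulrC.
rewrite word_sumS /comp /=.
rewrite -(IH d (F \o cons None)) -(IH d.+1 (F \o cons service)).
have -> : p arrival * word_sum p n (fun x =>
      ((0 < d)%N && nonneg_from d.-1 x)%:R *
      (F (arrival :: x) * \sum_(k < (level d.-1 x).+1) rho ^+ k)) =
    p arrival * \sum_(k < d) rho ^+ k *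
      word_sum p n (F \o cons arrival \o pitman k).
  case: d => [|d]; last by rewrite IH.
  rewrite big_ord0 (@eq_word_sum _ _ _ _ (fun=> 0)) ?word_sum_cst0// => x.
  by rewrite mul0r.
under eq_bigr do rewrite word_sumS !mulrDr.
rewrite !big_split/= -addrA -addrA; congr (_ + _).
  by rewrite mulr_sumr; apply: eq_bigr => i _; rewrite mulrCA.
(* Isolate [k = 0] on both sides: on the left it is the unused service, which
   becomes the [k = 0] term of the image service. *)
rewrite [X in _ = _ + p service * X]big_ord_recl/=.
rewrite mulrDr.
rewrite [X in _ + X = _]big_ord_recl/= !expr0 !mul1r.
rewrite addrCA [RHS]addrCA; congr (_ + _).
rewrite [LHS]addrC; congr (_ + _).
  rewrite mulr_sumr; apply: eq_bigr => i _.
  by rewrite p_arrival /bump/= add1n exprS; rewrite /comp/=; ring.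
rewrite mulr_sumr; apply: eq_bigr => i _.
by rewrite p_arrival /bump/= add1n exprS; rewrite /comp/=; ring.
Qed.

(** The case [d = 0] with the geometric sum evaluated. *)
Corollary word_sum_pitman0 n (F : seq letter -> R) :
  (1 - rho) * word_sum p n (F \o pitman 0) =
  word_sum p n (fun x => (nonneg_from 0 x)%:R * F x) -
  word_sum p n (fun x => (nonneg_from 0 x)%:R * F x * rho ^+ (level 0 x).+1).
Proof.
have := word_sum_pitman n 0 F; rewrite big_ord1 expr0 mul1r => ->.
rewrite -word_sumB -word_sumZ; apply: eq_word_sum => x.
have : (1 - rho) * \sum_(k < (level 0 x).+1) rho ^+ k =
    1 - rho ^+ (level 0 x).+1.
  by rewrite -[RHS]opprB subrX1 -mulNr opprB.
by set s := \sum_(_ < _) _; move=> h; rewrite mulrCA (mulrCA _ (F x)) h; ring.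
Qed.

(** Bounding [rho ^ (D + 1)] by [r ^ D], with [r] the square root of [rho],
    tilts the service and arrival weights by [r] and [1 / r], which turns both
    into [r * p service].  The rate of decay is best at the square root: the
    base [rho] itself would give a martingale and no decay. *)
Lemma word_sum_discounted_le (r : R) n d : 0 <= r <= 1 -> rho = r ^+ 2 ->
  (forall a, 0 <= p a) ->
  word_sum p n (fun x => (nonneg_from d x)%:R * rho ^+ (level d x).+1) <=
  r ^+ d * (p None + 2 * r * p service) ^+ n.
Proof.
move=> /andP[r0 r1] rhoE p0; elim: n d => [|n IH] d.
  rewrite word_sum0/= mul1r mulr1 rhoE -exprM.
  by rewrite ler_wiXn2l// mul2n -addnn (leq_trans (leqnSn d))// leq_addr.
set Z := p None + _.
have Zn0 : 0 <= Z ^+ n by rewrite exprn_ge0// addr_ge0// !mulr_ge0.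
rewrite word_sumS /comp /= [X in _ <= _ * X]exprS.
have h1 := ler_wpM2l (p0 None) (IH d).
have h2 := ler_wpM2l (p0 service) (IH d.+1).
have h3 : p arrival * word_sum p n (fun x =>
      ((0 < d)%N && nonneg_from d.-1 x)%:R *
      rho ^+ (level d.-1 x).+1) <= p service * (r ^+ d.+1 * Z ^+ n).
  case: d {h1 h2} => [|d].
    rewrite (@eq_word_sum _ _ _ _ (fun=> 0)) ?word_sum_cst0 ?mulr0//; last first.
      by move=> x; rewrite mul0r.
    by rewrite !mulr_ge0// exprn_ge0.
  apply: le_trans (ler_wpM2l (p0 arrival) (IH d)) _.
  by rewrite p_arrival rhoE !exprS le_eqVlt; apply/orP; left; apply/eqP; ring.
apply: (le_trans (lerD (lerD h1 h3) h2)).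
rewrite le_eqVlt; apply/orP; left; apply/eqP; rewrite {2}/Z exprS; ring.
Qed.

End discrete_pitman.

(** * Paths observed on a grid *)

Section grid_paths.
Context {R : realType}.
Variable h : R.
Hypothesis h_gt0 : 0 < h.
Implicit Types (f g : D0 R) (j k d : nat) (x : seq letter).

(** From the grid point [j] on, the cell increments of [(f, g)] spell [x]. *)
Definition follows (f g : R -> R) j x : Prop :=
  forall i, (i < size x)%N ->
    f ((j + i).+1%:R * h) - f ((j + i)%:R * h) = (nth None x i == arrival)%:R /\
    g ((j + i).+1%:R * h) - g ((j + i)%:R * h) = (nth None x i == service)%:R.

Lemma follows_cons (f g : R -> R) j a x : follows f g j (a :: x) <->
  [/\ f (j.+1%:R * h) - f (j%:R * h) = (a == arrival)%:R,
      g (j.+1%:R * h) - g (j%:R * h) = (a == service)%:R &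
      follows f g j.+1 x].
Proof.
split=> [fg|[fa ga fg] [|i] ix]; last first.
- by have := fg i ix; rewrite addSnnS.
- by rewrite addn0.
split; first by have /= := (fg 0%N isT).1; rewrite addn0.
  by have /= := (fg 0%N isT).2; rewrite addn0.
by move=> i ix; have := fg i.+1 ix; rewrite addSnnS.
Qed.

Lemma runinf_cell (w : R -> R) (u v : R) : cadlag w -> 0 <= u -> u <= v ->
  (forall s, u <= s <= v -> Num.min (w u) (w v) <= w s) ->
  runinf w v = Num.min (runinf w u) (w v).
Proof.
move=> cw u0 uv wuv; have v0 := le_trans u0 uv.
apply/eqP; rewrite eq_le; apply/andP; split.
  by rewrite le_min runinf_nonincreasing// runinf_le// v0 lexx.
apply: le_runinf => // s /andP[s0 sv]; have [su|us] := leP s u.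
  by rewrite ge_min runinf_le// s0.
have /wuv : u <= s <= v by rewrite (ltW us).
apply: le_trans; rewrite le_min !ge_min lexx orbT andbT.
by rewrite runinf_le// u0 lexx.
Qed.

Lemma maxconvE f g (t : R) : 0 <= t ->
  maxconv g f t = f t - runinf (fun s => f s - g s) t.
Proof.
move=> t0; rewrite maxconvN minconvE//; try exact/cadlagN/path_cadlag.
rewrite (_ : (fun s => _) = fun s => f s - g s); first ring.
by apply/funext => s; rewrite opprK addrC.
Qed.

(** The queue length [k] at the grid point [j] is [f] minus the departures.
    Monotonicity of [f] and [g], together with the constancy of one of them
    over each cell, is what reduces the running infimum to grid values. *)
Lemma Gamma2_follows f g j k x : {homo f : s t / s <= t} ->
  {homo g : s t / s <= t} -> follows f g j x ->
  f (j%:R * h) - minconv f g (j%:R * h) = k%:R ->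
  follows (minconv f g) (maxconv g f) j (pitman k x).
Proof.
move=> fmono gmono.
have cw : cadlag (fun s => f s - g s).
  by apply: cadlagD; [|apply: cadlagN]; exact: path_cadlag.
elim: x j k => [//|a x IH] j k /follows_cons[].
have := IH j.+1; clear IH.
set u := j%:R * h; set v := j.+1%:R * h.
have u0 : 0 <= u by rewrite mulr_ge0// ltW.
have uv : u <= v by rewrite ler_wpM2r ?ler_nat ?(ltW h_gt0).
have v0 := le_trans u0 uv.
have Iu : runinf (fun s => f s - g s) u <= f u - g u.
  by apply: runinf_le => //; rewrite u0 lexx.
have Iv : (f v = f u \/ g v = g u) -> runinf (fun s => f s - g s) v =
    Num.min (runinf (fun s => f s - g s) u) (f v - g v).
  move=> fgE; apply: runinf_cell => // s /andP[us sv].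
  (* [f - g] is nonincreasing on the cell when [f] is constant there, and
     nondecreasing when [g] is. *)
  have := (fmono _ _ us, fmono _ _ sv, gmono _ _ us, gmono _ _ sv).
  rewrite ge_min => -[[[fus fsv] gus] gsv].
  by case: fgE => e; apply/orP; [right|left]; lra.
rewrite !minconvE//; try exact: path_cadlag.
move=> IH fE gE fg qE.
have {IH} IH k' : f v - g v - runinf (fun s => f s - g s) v = k'%:R ->
    follows (minconv f g) (maxconv g f) j.+1 (pitman k' x).
  by move=> e; apply: IH => //; rewrite -e; ring.
have cell b y : runinf (fun s => f s - g s) v + g v -
      (runinf (fun s => f s - g s) u + g u) = (b == arrival)%:R ->
    (f v - runinf (fun s => f s - g s) v) -
      (f u - runinf (fun s => f s - g s) u) = (b == service)%:R ->
    follows (minconv f g) (maxconv g f) j.+1 y ->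
    follows (minconv f g) (maxconv g f) j (b :: y).
  by move=> e1 e2 e3; apply/follows_cons; rewrite !maxconvE// !minconvE//;
    try exact: path_cadlag.
move: Iu Iv IH cell qE; set I := runinf _ u; set J := runinf _ v.
move=> Iu Iv IH cell qE.
have k0 : 0 <= k%:R :> R by [].
case: a fE gE => [[]|] /= fE gE.
- have {}Iv := Iv (or_introl _); case: k qE k0 => [|k] qE k0.
  (* An unused service: the running infimum moves down with [f - g]. *)
  + have {}Iv : J = f v - g v.
      by rewrite Iv ?min_r//; lra.
    apply: cell => //=; [lra|lra|].
    by apply: IH; rewrite Iv; lra.
  (* A departure: as [f - g] was at least 1 above its running infimum, the
     latter does not move. *)
  + have k1 : 0 <= k%:R :> R by [].
    move: qE; rewrite -natr1 => qE.
    have {}Iv : J = I by rewrite Iv ?min_l//; lra.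
    apply: cell => //=; [lra|lra|].
    by apply: IH; lra.
- have {}Iv : J = I by rewrite Iv ?min_l//; [lra|right; lra].
  apply: cell => //=; [lra|lra|].
  by apply: IH; rewrite -natr1; lra.
- have {}Iv : J = I by rewrite Iv ?min_l//; [lra|right; lra].
  apply: cell => //=; [lra|lra|].
  by apply: IH; lra.
Qed.

Lemma follows_nonneg (f g : R -> R) j d x : follows f g j x ->
  g (j%:R * h) - f (j%:R * h) = d%:R ->
  nonneg_from d x <->
  forall i, (i <= size x)%N -> f ((j + i)%:R * h) <= g ((j + i)%:R * h).
Proof.
elim: x j d => [|a x IH] j d.
  move=> _ gf; split=> // _ [|//] _.
  by rewrite addn0 -subr_ge0 gf.
move=> /follows_cons[fE gE fg] gf.
have step c : g (j.+1%:R * h) - f (j.+1%:R * h) = c%:R ->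
    nonneg_from c x <-> forall i, (i <= size (a :: x))%N ->
      f ((j + i)%:R * h) <= g ((j + i)%:R * h).
  move=> gf1; rewrite (IH _ _ fg gf1); split=> le i ix; last first.
    by rewrite addSnnS; exact: le.
  case: i ix => [|i] ix; first by rewrite addn0 -subr_ge0 gf.
  by rewrite -addSnnS; exact: le.
case: a fE gE step => [[]|] /= fE gE step.
- by apply: step; rewrite -[d.+1%:R]natr1; lra.
- case: d gf => [|d] gf /=.
    split=> // /(_ 1%N isT); rewrite addn1 => le1.
    by exfalso; lra.
  by apply: step; move: gf; rewrite -[d.+1%:R]natr1; lra.
- by apply: step; lra.
Qed.

Lemma follows_eq (f g f' g' : R -> R) j x : follows f g j x ->
  follows f' g' j x -> f (j%:R * h) = f' (j%:R * h) ->
  g (j%:R * h) = g' (j%:R * h) ->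
  forall i, (i <= size x)%N -> f ((j + i)%:R * h) = f' ((j + i)%:R * h) /\
                            g ((j + i)%:R * h) = g' ((j + i)%:R * h).
Proof.
elim: x j => [|a x IH] j; first by move=> _ _ ff gg [|//]; rewrite addn0.
move=> /follows_cons[fE gE fg] /follows_cons[fE' gE' fg'] ff gg [|i] ix.
  by rewrite addn0.
by rewrite -addSnnS; apply: IH => //; lra.
Qed.

(** Distinct words are spelled by disjoint sets of paths. *)
Lemma follows_inj (f g : R -> R) j x y : size x = size y ->
  follows f g j x -> follows f g j y -> x = y.
Proof.
elim: x y j => [|a x IH] [|b y] j //= [xy].
move=> /follows_cons[fE gE fg] /follows_cons[fE' gE' fg'].
congr cons; last exact: IH fg'.
move: fE gE; rewrite fE' gE' => /eqP + /eqP; rewrite !eqr_nat.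
by case: a b {fE' gE'} => [[]|] [[]|].
Qed.

Lemma size_pitman k x : size (pitman k x) = size x.
Proof. by elim: x k => [//|[[]|] x IH] [|k] /=; rewrite IH. Qed.

End grid_paths.

(** * Probability of a word *)

Section one_process.
Context {R : realType} (h : R).
Hypothesis h_gt0 : 0 < h.

Definition cell_counts N (k : 'I_N -> nat) : set (D0 R) :=
  [set f : D0 R | forall i : 'I_N, f (i.+1%:R * h) - f (i%:R * h) = (k i)%:R].

Lemma measurable_cell_counts N (k : 'I_N -> nat) : measurable (cell_counts k).
Proof.
rewrite (_ : cell_counts k = \bigcap_(i in [set: 'I_N])
    [set f : D0 R | f (i.+1%:R * h) - f (i%:R * h) = (k i)%:R]); last first.
  by apply/seteqP; split=> f fk i; [move=> _|]; exact: fk.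
apply: fin_bigcap_measurable => // i _.
have : measurable_fun setT (fun f : D0 R => f (i.+1%:R * h) - f (i%:R * h)).
  by apply: measurable_funB; exact: measurable_eval.
by move=> /(_ measurableT _ (measurable_set1 (k i)%:R)); rewrite setTI.
Qed.

Lemma prob_cell_counts d (T : measurableType d) (P : probability T R) (nu : R)
    (X : {RV P >-> D0 R}) N (k : 'I_N -> nat) : poisson_process P nu X ->
  P (X @^-1` cell_counts k) = (\prod_(i < N) poisson_pmf (nu * h) (k i))%:E.
Proof.
move=> pX.
have tmono : {homo (fun i : nat => i%:R * h) : i j / (i <= j)%N >-> i <= j}.
  by move=> i j ij; rewrite ler_wpM2r ?ler_nat// ltW.
have t0 : 0 <= 0%:R * h by rewrite mul0r.
have := poisson_independent pX t0 tmono (B := fun i : 'I_N => [set (k i)%:R]).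
rewrite -prodEFin => indep.
transitivity (P (\bigcap_(i in [set: 'I_N])
    (increment X (i%:R * h) (i.+1%:R * h) @^-1` [set (k i)%:R]))).
  congr (P _); apply/seteqP; split=> w Xw i; [move=> _|]; exact: Xw.
rewrite indep//; apply: eq_bigr => i _.
have i0 : 0 <= i%:R * h by rewrite mulr_ge0// ltW.
have ii : i%:R * h < i.+1%:R * h by rewrite ltr_pM2r// ltr_nat.
rewrite (poisson_increment pX _ i0 ii).
by congr (poisson_pmf _ _)%:E; rewrite -mulrBl -natrB// subSnn mul1r.
Qed.

End one_process.

Section words_of_processes.
Context d (T : measurableType d) {R : realType} (P : probability T R).
Context (lambda mu h : R) (A S : {RV P >-> D0 R}).
Hypothesis h_gt0 : 0 < h.
Hypothesis A_poisson : poisson_process P lambda A.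
Hypothesis S_poisson : poisson_process P mu S.
Hypothesis AS_independent : independent_RV2 P A S.

Definition letter_prob (a : letter) : R :=
  poisson_pmf (lambda * h) (a == arrival) * poisson_pmf (mu * h) (a == service).

Definition word_event (x : seq letter) : set T :=
  [set w | follows h (A w) (S w) 0 x].

Lemma word_eventE (x : seq letter) : word_event x =
  A @^-1` cell_counts h (fun i : 'I_(size x) => nth None x i == arrival) `&`
  S @^-1` cell_counts h (fun i : 'I_(size x) => nth None x i == service).
Proof.
apply/seteqP; split=> [w xw|w [Aw Sw] i ix].
  by split=> i; have [] := xw i (ltn_ord i).
by split; [exact: (Aw (Ordinal ix))|exact: (Sw (Ordinal ix))].
Qed.

Lemma measurable_word_event x : measurable (word_event x).
Proof.
rewrite word_eventE; apply: measurableI; rewrite -[X in measurable X]setTI;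
  apply: measurable_funPT => //; exact: measurable_cell_counts.
Qed.

Lemma prob_word_event x : P (word_event x) = (\prod_(a <- x) letter_prob a)%:E.
Proof.
rewrite word_eventE AS_independent; try exact: measurable_cell_counts.
rewrite (prob_cell_counts h_gt0 _ A_poisson) (prob_cell_counts h_gt0 _ S_poisson).
rewrite -EFinM -big_split/=; congr EFin.
by rewrite (big_nth None) big_mkord.
Qed.

(** Every cell contains at most one jump of [A] and [S] together. *)
Definition simple_event N : set T :=
  [set w | exists x : N.-tuple letter, word_event x w].

(** An event that is decided by the word is, inside [simple_event], a finite
    disjoint union of word events. *)
Lemma simple_eventI (N : nat) (Q : set T) (b : pred (seq letter)) :
  (forall (x : N.-tuple letter) w, word_event x w -> (Q w <-> b x)) ->
  Q `&` simple_event N =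
  \bigcup_(x in [set` enum {: N.-tuple letter}])
    if b x then word_event x else set0.
Proof.
move=> Qb; apply/seteqP; split=> [w [Qw [x xw]]|w [x _]].
  exists x; first by rewrite /= mem_enum.
  by rewrite ((Qb x w xw).1 Qw).
by case: ifPn => // bx xw; split; [exact/(Qb x w xw)|exists x].
Qed.

Lemma measurable_simple_event N : measurable (simple_event N).
Proof.
rewrite -[simple_event N]setTI (@simple_eventI _ setT predT)//.
apply: fin_bigcup_measurable; first exact: finite_finset.
by move=> x _; exact: measurable_word_event.
Qed.

Lemma prob_simple_eventI (N : nat) (Q : set T) (b : pred (seq letter)) :
  (forall (x : N.-tuple letter) w, word_event x w -> (Q w <-> b x)) ->
  P (Q `&` simple_event N) = (word_sum letter_prob N (fun x => (b x)%:R))%:E.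
Proof.
move=> Qb; rewrite (simple_eventI Qb) measure_fin_bigcup//; last 2 first.
- apply/trivIsetP => x y _ _ xy; apply/seteqP; split=> // w [].
  case: ifP => // _ xw; case: ifP => // _ yw.
  move/eqP: xy; apply; apply: val_inj; apply: follows_inj xw yw.
  by rewrite !size_tuple.
- by move=> x _; case: ifP => // _; exact: measurable_word_event.
rewrite -fsbig_seq ?enum_uniq// /word_sum -sumEFin big_enum/=.
apply: eq_bigr => x _; case: ifP => _; first by rewrite prob_word_event mulr1.
by rewrite measure0 mulr0.
Qed.

End words_of_processes.

(** * The identity on one grid, with error *)

Section letter_probabilities.
Context {R : realType} (lambda mu h : R).
Hypotheses (lambda_gt0 : 0 < lambda) (mu_gt0 : 0 < mu) (h_gt0 : 0 < h).

Let p := letter_prob lambda mu h.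

Lemma poisson_pmf0 (r : R) : 0 < r -> poisson_pmf r 0 = expR (- r).
Proof. by move=> r0; rewrite /poisson_pmf r0 expr0 fact0 invr1 !mul1r. Qed.

Lemma poisson_pmf1 (r : R) : 0 < r -> poisson_pmf r 1 = r * expR (- r).
Proof. by move=> r0; rewrite /poisson_pmf r0 expr1 invr1 mulr1. Qed.

Lemma letter_probE : [/\ p None = expR (- ((lambda + mu) * h)),
  p arrival = lambda * h * expR (- ((lambda + mu) * h)) &
  p service = mu * h * expR (- ((lambda + mu) * h))].
Proof.
have lh : 0 < lambda * h by rewrite mulr_gt0.
have mh : 0 < mu * h by rewrite mulr_gt0.
have -> : expR (- ((lambda + mu) * h)) = expR (- (lambda * h)) * expR (- (mu * h)).
  by rewrite -expRD; congr expR; ring.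
by rewrite /p /letter_prob/= !poisson_pmf0// !poisson_pmf1//; split; ring.
Qed.

Lemma letter_prob_ge0 a : 0 <= p a.
Proof. by rewrite mulr_ge0// poisson_pmf_ge0. Qed.

Lemma sub1r_expr_le (u : R) n : 0 <= u <= 1 -> 1 - u ^+ n <= n%:R * (1 - u).
Proof.
move=> /andP[u0 u1]; elim: n => [|n IH]; first by rewrite expr0 mul0r subrr.
have un : u ^+ n <= 1 by rewrite exprn_ile1.
rewrite exprS -natr1 mulrDl mul1r; nra.
Qed.

(** With [t = (lambda + mu) * h], a cell is good with probability
    [(1 + t) exp(-t)], which is at least [(1 + t) (1 - t) = 1 - t ^ 2]. *)
Lemma prob_not_simple_le N :
  1 - word_sum p N (fun=> 1) <= N%:R * ((lambda + mu) * h) ^+ 2.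
Proof.
rewrite word_sum1; have [-> -> ->] := letter_probE.
set t := (lambda + mu) * h; have t0 : 0 < t by rewrite mulr_gt0// addr_gt0.
have -> : expR (- t) + lambda * h * expR (- t) + mu * h * expR (- t) =
    (1 + t) * expR (- t) by rewrite /t; ring.
have et : expR (- t) * expR t = 1 by rewrite -expRD addNr expR0.
have e0 := expR_gt0 (- t).
have e1 := expR_ge1Dx (- t).
have e2 := expR_ge1Dx t.
apply: le_trans (sub1r_expr_le _ _) _; first by apply/andP; split; nra.
rewrite ler_wpM2l//; nra.
Qed.

(** At [r ^ 2 = lambda / mu] the rate [lambda + mu - 2 r mu] is the square of
    [sqrt mu - sqrt lambda]. *)
Lemma discounted_factor_le (r : R) N : 0 <= r ->
  (p None + 2 * r * p service) ^+ N <=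
  expR (- ((lambda + mu - 2 * r * mu) * (N%:R * h))).
Proof.
move=> r0; have [-> _ ->] := letter_probE.
have -> : - ((lambda + mu - 2 * r * mu) * (N%:R * h)) =
  N%:R * (- ((lambda + mu) * h) + 2 * r * mu * h).
  by ring.
rewrite expRM_natl; apply: lerXn2r.
- by rewrite nnegrE !addr_ge0 ?expR_ge0// !mulr_ge0// ?expR_ge0// ltW.
- by rewrite nnegrE expR_ge0.
rewrite expRD.
have := ler_wpM2l (expR_ge0 (- ((lambda + mu) * h))) (expR_ge1Dx (2 * r * mu * h)).
by apply: le_trans; rewrite le_eqVlt; apply/orP; left; apply/eqP; ring.
Qed.

End letter_probabilities.

Section one_grid.
Context d (T : measurableType d) {R : realType} (P : probability T R).
Context (lambda mu h : R) (A S : {RV P >-> D0 R}).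
Hypotheses (lambda_gt0 : 0 < lambda) (lambda_lt_mu : lambda < mu).
Hypothesis h_gt0 : 0 < h.
Hypothesis A_poisson : poisson_process P lambda A.
Hypothesis S_poisson : poisson_process P mu S.
Hypothesis AS_independent : independent_RV2 P A S.
Implicit Types (N : nat) (C : set (D0 R * D0 R)) (Q : set T).

Definition grid_determined (h : R) N C : Prop :=
  forall y z : D0 R * D0 R,
    (forall k, (k <= N)%N -> y.1 (k%:R * h) = z.1 (k%:R * h) /\
                             y.2 (k%:R * h) = z.2 (k%:R * h)) ->
    C y -> C z.

Definition ordered_on_grid (h : R) N : set (D0 R * D0 R) :=
  [set y : D0 R * D0 R | forall k, (k <= N)%N -> y.1 (k%:R * h) <= y.2 (k%:R * h)].

(** For a grid-determined [C], membership of a path pair spelling [x] depends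
    only on [x]; this is the common answer. *)
Definition word_in C (x : seq letter) : bool :=
  `[< exists2 y : D0 R * D0 R, C y & follows h y.1 y.2 0 x >].

(** Null initial values and equal words force equal values on the grid. *)
Lemma word_inP N C x (y : D0 R * D0 R) : grid_determined h N C -> size x = N ->
  follows h y.1 y.2 0 x -> C y <-> word_in C x.
Proof.
move=> detC sx yx; split=> [Cy|/asboolP[z Cz zx]]; first by apply/asboolP; exists y.
apply: detC Cz => k kN; rewrite -[k]add0n.
by apply: (follows_eq zx yx); rewrite ?mul0r ?path_le0 ?sx.
Qed.

Lemma measurable_ordered_on_grid N : measurable (ordered_on_grid h N).
Proof.
rewrite (_ : ordered_on_grid h N = \bigcap_(k in [set k | (k <= N)%N])
    [set y : D0 R * D0 R | y.1 (k%:R * h) <= y.2 (k%:R * h)]).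
  apply: bigcap_measurableType => k _; rewrite -[X in measurable X]setTI.
  have m1 : measurable_fun setT (fun y : D0 R * D0 R => y.1 (k%:R * h)).
    exact: (measurableT_comp (measurable_eval _) measurable_fst).
  have m2 : measurable_fun setT (fun y : D0 R * D0 R => y.2 (k%:R * h)).
    exact: (measurableT_comp (measurable_eval _) measurable_snd).
  by have /(_ measurableT [set true]) := measurable_fun_ler m1 m2; exact.
by apply/seteqP; split.
Qed.

Lemma measurable_preimage_joint C : measurable C ->
  measurable (joint A S @^-1` C).
Proof.
by move=> mC; rewrite -[X in measurable X]setTI; exact: measurable_joint.
Qed.

Lemma measurable_preimage_Gamma2 C : measurable C ->
  measurable ((@Gamma2 R \o joint A S) @^-1` C).
Proof.
move=> mC; rewrite comp_preimage; apply: measurable_preimage_joint.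
by rewrite -[X in measurable X]setTI; exact: measurable_Gamma2.
Qed.

Let pr Q : R := fine (P Q).
Let simple N := simple_event h A S N.
Let p := letter_prob lambda mu h.

Let prE Q : measurable Q -> P Q = (pr Q)%:E.
Proof. by move=> mQ; rewrite /pr fineK// fin_num_measure. Qed.

Lemma simple_event_approx N Q : measurable Q ->
  `|pr Q - pr (Q `&` simple N)| <= 1 - pr (simple N).
Proof.
move=> mQ; have mG := measurable_simple_event h A S N.
have mQG : measurable (Q `&` simple N) by exact: measurableI.
have mQNG : measurable (Q `&` ~` simple N).
  by apply: measurableI => //; exact: measurableC.
have -> : pr Q = pr (Q `&` simple N) + pr (Q `&` ~` simple N).
  apply: EFin_inj; rewrite EFinD -!prE//.
  rewrite -measureU//; first by rewrite -setIUr setUv setIT.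
  by rewrite setIACA setICr setI0.
rewrite addrC addKr ger0_norm; last by rewrite fine_ge0.
rewrite -lee_fin EFinB -!prE//.
rewrite -probability_setC//; apply: le_measure; rewrite ?inE//.
exact: measurableC.
Qed.

(** The identity of [word_sum_pitman0], read on the paths. *)
Lemma grid_identity N C : grid_determined h N C ->
  (1 - lambda / mu) *
    pr ((@Gamma2 R \o joint A S) @^-1` C `&` simple N) =
  pr (joint A S @^-1` (C `&` ordered_on_grid h N) `&` simple N) -
  word_sum p N (fun x => (nonneg_from 0 x)%:R * (word_in C x)%:R *
                         (lambda / mu) ^+ (level 0 x).+1).
Proof.
move=> detC; have mu_gt0 := lt_trans lambda_gt0 lambda_lt_mu.
have p_arrival : p arrival = lambda / mu * p service.
  rewrite /p; have [_ -> ->] := letter_probE lambda_gt0 mu_gt0 h_gt0.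
  by field; rewrite gt_eqF.
have zero0 (y : D0 R) : y (0%:R * h) = 0 by rewrite mul0r path_le0.
rewrite /pr.
rewrite (prob_simple_eventI h_gt0 A_poisson S_poisson AS_independent
  (b := word_in C \o pitman 0)); last first.
  move=> x w xw; apply: (word_inP (y := Gamma2 (joint A S w)) detC).
    by rewrite size_pitman size_tuple.
  apply: (Gamma2_follows h_gt0 _ _ xw).
  - exact: (poisson_counting A_poisson w).1.
  - exact: (poisson_counting S_poisson w).1.
  - rewrite zero0 (_ : minconv _ _ _ = 0) ?subrr//.
    by rewrite mul0r; exact: (path_le0 (D0_minconv (A w) (S w)) (lexx 0)).
rewrite (prob_simple_eventI h_gt0 A_poisson S_poisson AS_independent
  (b := fun x => nonneg_from 0 x && word_in C x)); last first.
  move=> x w xw; have Cx := word_inP (y := joint A S w) detC (size_tuple x) xw.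
  have ox : nonneg_from 0 x <-> ordered_on_grid h N (joint A S w).
    rewrite (follows_nonneg xw (d := 0)) ?zero0 ?subrr//.
    by rewrite size_tuple.
  split=> [[/Cx -> /ox ->]//|/andP[/ox ? /Cx]]; by split.
rewrite (word_sum_pitman0 p_arrival _ (fun x => (word_in C x)%:R))/=.
by congr (_ - _); apply: eq_word_sum => x; rewrite -natrM mulnb.
Qed.

(** Two replacements of an event by its trace on [simple_event], plus the
    discounted term of [grid_identity]. *)
Lemma grid_error N C : measurable C -> grid_determined h N C ->
  `|(1 - lambda / mu) * pr ((@Gamma2 R \o joint A S) @^-1` C) -
    pr (joint A S @^-1` (C `&` ordered_on_grid h N))| <=
  2 * (N%:R * ((lambda + mu) * h) ^+ 2) +
  expR (- ((lambda + mu - 2 * Num.sqrt (lambda / mu) * mu) * (N%:R * h))).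
Proof.
move=> mC detC; have mu_gt0 := lt_trans lambda_gt0 lambda_lt_mu.
set rho := lambda / mu; set r := Num.sqrt rho.
have rho0 : 0 < rho by rewrite divr_gt0.
have rho1 : rho < 1 by rewrite ltr_pdivrMr ?mul1r.
have r0 : 0 <= r by rewrite sqrtr_ge0.
have rE : rho = r ^+ 2 by rewrite sqr_sqrtr// ltW.
have r1 : r <= 1 by nra.
have p0 := letter_prob_ge0 lambda mu h.
have p_arrival : p arrival = rho * p service.
  rewrite /p; have [_ -> ->] := letter_probE lambda_gt0 mu_gt0 h_gt0.
  by rewrite /rho; field; rewrite gt_eqF.
have mX := measurable_preimage_Gamma2 mC.
have mY := measurable_preimage_joint (measurableI _ _ mC
  (measurable_ordered_on_grid N)).
have := simple_event_approx N mX; have := simple_event_approx N mY.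
have := grid_identity detC; rewrite -/rho.
set e := word_sum _ _ _; set a := pr (_ @^-1` C); set b := pr (joint A S @^-1` _).
set x := pr _; set y := pr _ => xye.
have prG : pr (simple N) = word_sum p N (fun=> 1).
  rewrite /pr -[simple N]setTI.
  by rewrite (prob_simple_eventI h_gt0 A_poisson S_poisson AS_independent
    (b := predT)).
have := prob_not_simple_le lambda_gt0 mu_gt0 h_gt0 N; rewrite -/p -prG.
set g := 1 - _; set E := N%:R * _ => gE.
have := discounted_factor_le lambda_gt0 mu_gt0 h_gt0 N r0.
set Z := expR _ => eZ.
have e0 : 0 <= e.
  apply: word_sum_ge0 => // z; rewrite !mulr_ge0// exprn_ge0//; exact: ltW.
(* The expectation is over all words, so [C] may be forgotten. *)
have {}eZ : e <= Z.
  apply: le_trans eZ.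
  have r01 : 0 <= r <= 1 by rewrite r0.
  have := word_sum_discounted_le p_arrival N 0 r01 rE p0; rewrite expr0 mul1r.
  apply: le_trans.
  apply: ler_word_sum => // z; rewrite -mulrA; apply: ler_wpM2l => //.
  by rewrite ler_piMl ?exprn_ge0 ?(ltW rho0)//; case: word_in.
rewrite !ler_norml => /andP[yb1 yb2] /andP[xa1 xa2]; apply/andP; split; nra.
Qed.

End one_grid.

(** * Refining grids *)

Section grids.
Context {R : realType}.
Implicit Types (n m k : nat) (t : R) (C : set (D0 R * D0 R)).

(** Cells of length [4 ^ -n] on [[0, 2 ^ n]]: powers of a fixed ratio make the
    grids nested, and the choice of 8 makes the number of cells times the
    squared cell length equal to [2 ^ -n] while the covered range still tends to the
    half-line. *)
Definition mesh n : R := 4^-1 ^+ n.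
Definition ncells n : nat := (8 ^ n)%N.

Lemma mesh_gt0 n : 0 < mesh n.
Proof. by rewrite exprn_gt0// invr_gt0. Qed.

Lemma ncells_mesh n : (ncells n)%:R * mesh n = 2 ^+ n.
Proof. by rewrite /ncells /mesh natrX -exprMn; congr (_ ^+ n); lra. Qed.

Lemma ncells_mesh2 n : (ncells n)%:R * mesh n ^+ 2 = 2^-1 ^+ n.
Proof.
rewrite expr2 mulrA ncells_mesh /mesh -exprMn; congr (_ ^+ n); lra.
Qed.

Lemma mesh_refine m n k : (m <= n)%N ->
  k%:R * mesh m = (k * 4 ^ (n - m))%N%:R * mesh n.
Proof.
move=> mn; rewrite /mesh natrM natrX -mulrA; congr (_ * _).
have -> : 4^-1 ^+ n = 4^-1 ^+ (n - m) * 4^-1 ^+ m :> R by rewrite -exprD subnK.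
by rewrite mulrA -exprMn mulfV// expr1n mul1r.
Qed.

Lemma ncells_refine m n k : (m <= n)%N -> (k <= ncells m)%N ->
  (k * 4 ^ (n - m) <= ncells n)%N.
Proof.
move=> mn km; have -> : (ncells n = ncells m * 8 ^ (n - m))%N.
  by rewrite /ncells -expnD subnKC.
by rewrite leq_mul// (expnMn 2 4) leq_pmull// expn_gt0.
Qed.

Lemma grid_determined_refine m n C : (m <= n)%N ->
  grid_determined (mesh m) (ncells m) C -> grid_determined (mesh n) (ncells n) C.
Proof.
move=> mn detC y z yz; apply: detC => k km; rewrite (mesh_refine k mn).
exact: yz (ncells_refine mn km).
Qed.

Lemma ordered_on_grid_nonincreasing :
  nonincreasing_seq (fun n => ordered_on_grid (mesh n) (ncells n)).
Proof.
move=> m n mn; apply/subsetPset => y yn k km; rewrite (mesh_refine k mn).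
exact: yn (ncells_refine mn km).
Qed.

(** The successor makes the grid point lie strictly to the right of [t], where
    right-continuity applies. *)
Definition right_grid_index t n : nat := (Num.truncn (t * 4 ^+ n)).+1.

Lemma right_grid_point t n : 0 <= t ->
  t < (right_grid_index t n)%:R * mesh n <= t + mesh n.
Proof.
move=> t0; have m0 := mesh_gt0 n.
have m4 : mesh n * 4 ^+ n = 1 by rewrite /mesh -exprMn mulVf// expr1n.
have t4 : 0 <= t * 4 ^+ n by rewrite mulr_ge0// exprn_ge0.
have /andP[le_t t_lt] := truncn_itv t4.
have tE : t = t * 4 ^+ n * mesh n by rewrite -mulrA [4 ^+ n * _]mulrC m4 mulr1.
rewrite {1 4}tE /right_grid_index ltr_pM2r// t_lt/=.
by rewrite -natr1 mulrDl mul1r lerD2r ler_pM2r.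
Qed.

Lemma mesh_cvg : mesh n @[n --> \oo] --> 0.
Proof. by apply: cvg_expr; rewrite ger0_norm ?invr_ge0// invf_lt1// ltr1n. Qed.

Lemma right_grid_point_cvg t : 0 <= t ->
  (right_grid_index t n)%:R * mesh n @[n --> \oo] --> t.
Proof.
move=> t0; apply: (@squeeze_cvgr _ _ _ _ (cst t) (fun n => t + mesh n)).
- by apply: nearW => n; have /andP[/ltW -> ->] := right_grid_point n t0.
- exact: cvg_cst.
- by rewrite -[X in _ --> X]addr0; apply: cvgD; [exact: cvg_cst|exact: mesh_cvg].
Qed.

Lemma D0_right_grid_cvg (f : D0 R) t : 0 <= t ->
  f ((right_grid_index t n)%:R * mesh n) @[n --> \oo] --> f t.
Proof.
move=> t0; have [/(_ t) rf _] := path_cadlag f.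
apply: (cvg_at_rightP _ _ _).1 rf _ _; split; last exact: right_grid_point_cvg.
by move=> n; have /andP[] := right_grid_point n t0.
Qed.

Lemma near_right_grid_index t : 0 <= t ->
  \forall n \near \oo, (right_grid_index t n <= ncells n)%N.
Proof.
move=> t0; exists (Num.truncn (t + 1)).+1 => // n /= tn.
have m0 := mesh_gt0 n.
rewrite -(ler_nat R) -(ler_pM2r m0) ncells_mesh.
have /andP[_ /le_trans] := right_grid_point n t0; apply.
have m1 : mesh n <= 1 by rewrite exprn_ile1// ?invr_ge0// invf_le1// ler1n.
apply: (@le_trans _ _ (t + 1)); first by rewrite lerD2l.
have t1 : t + 1 < n%:R.
  by rewrite (lt_le_trans (truncnS_gt _))// ler_nat.
by rewrite (le_trans (ltW t1))// -natrX ler_nat ltnW// ltn_expl.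
Qed.

(** Values at arbitrary times are limits of values at grid points on the right,
    and these points eventually lie inside the range of their grid. *)
Lemma bigcap_ordered_on_grid :
  \bigcap_n ordered_on_grid (mesh n) (ncells n) = @ordered_paths R.
Proof.
apply/seteqP; split=> [y yn t t0|y y12 n _ k _]; last first.
  by apply: y12; rewrite mulr_ge0// ltW// mesh_gt0.
have c1 := D0_right_grid_cvg (f := y.1) t0; have c2 := D0_right_grid_cvg (f := y.2) t0.
apply: ler_cvg_to c1 c2 _.
by apply: filterS (near_right_grid_index t0) => n; exact: yn.
Qed.

(** Events of two different grids can be intersected because both are determined
    by the finer one. *)
Definition grid_events : set (set (D0 R * D0 R)) :=
  [set C | measurable C /\ exists n, grid_determined (mesh n) (ncells n) C].

Lemma grid_events_setI : setI_closed grid_events.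
Proof.
move=> B C [mB [m dB]] [mC [n dC]]; split; first exact: measurableI.
have {}dB := grid_determined_refine (leq_maxl m n) dB.
have {}dC := grid_determined_refine (leq_maxr m n) dC.
by exists (maxn m n) => y z yz [/(dB _ _ yz) Bz /(dC _ _ yz) Cz].
Qed.

Lemma grid_events_setT : grid_events setT.
Proof. by split; [exact: measurableT|exists 0%N]. Qed.

(** The point [k * mesh n] may exceed the range of the grid [n]; it belongs to
    the grid [maxn n k] since [k < 2 ^ k]. *)
Lemma grid_event_at (proj : D0 R * D0 R -> D0 R) n k (B : set R) :
  proj = fst \/ proj = snd -> measurable B ->
  grid_events [set y | B (proj y (k%:R * mesh n))].
Proof.
move=> projE mB; split.
  have mproj : measurable_fun setT proj.
    by case: projE => ->; [exact: measurable_fst|exact: measurable_snd].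
  have := measurableT_comp (measurable_eval (k%:R * mesh n)) mproj.
  by move=> /(_ measurableT _ mB); rewrite setTI.
exists (maxn n k) => y z yz /=.
have nm := leq_maxl n k; have km := leq_maxr n k.
set m := maxn n k in yz nm km *.
have : (k * 4 ^ (m - n) <= ncells m)%N.
  rewrite /ncells (expnMn 2 4) leq_mul//.
    by rewrite (leq_trans km)// ltnW// ltn_expl.
  by rewrite leq_exp2l// leq_subr.
move=> /yz[y1 y2]; rewrite (mesh_refine k nm).
by case: projE => ->; [rewrite y1|rewrite y2].
Qed.

(** The evaluation at [t] is the pointwise limit of the evaluations at grid
    points decreasing to [t], hence measurable for the generated
    sigma-algebra. *)
Lemma grid_events_generate : measurable = <<s grid_events >>.
Proof.
apply/seteqP; split; last first.
  apply: smallest_sub; first exact: sigma_algebra_measurable.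
  by move=> C [].
pose U := g_sigma_algebraType grid_events.
have mproj proj : proj = fst \/ proj = snd ->
    measurable_fun setT (proj : U -> D0 R).
  move=> projE; apply: measurable_fun_D0 => t.
  have [t0|t0] := leP t 0.
    by under eq_fun do rewrite path_le0//; exact: measurable_cst.
  apply: (measurable_fun_cvg (h := fun n (y : U) =>
      proj y ((right_grid_index t n)%:R * mesh n))).
    move=> n _ B mB; rewrite setTI; apply: sub_sigma_algebra.
    exact: grid_event_at.
  by move=> y _; apply: D0_right_grid_cvg; exact: ltW.
have mid : measurable_fun setT (fun y : U => (y.1, y.2) : D0 R * D0 R).
  by apply: measurable_fun_pair; apply: mproj; [left|right].
move=> C mC; have := mid measurableT C mC; rewrite setTI.
by rewrite (_ : _ @^-1` C = C)//; apply/seteqP; split => -[].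
Qed.

End grids.

Section limit.
Context d (T : measurableType d) {R : realType} (P : probability T R).
Context (lambda mu : R) (A S : {RV P >-> D0 R}).
Hypotheses (lambda_gt0 : 0 < lambda) (lambda_lt_mu : lambda < mu).
Hypothesis A_poisson : poisson_process P lambda A.
Hypothesis S_poisson : poisson_process P mu S.
Hypothesis AS_independent : independent_RV2 P A S.
Implicit Type C : set (D0 R * D0 R).

(** Both errors of [grid_error] are of order [2 ^ -n]; for the exponential one
    this is [exp(- y) <= 1 / y] with [y = kappa * 2 ^ n]. *)
Lemma grid_error_geometric : exists K : R, forall n C, measurable C ->
  grid_determined (mesh n) (ncells n) C ->
  `|(1 - lambda / mu) * fine (P ((@Gamma2 R \o joint A S) @^-1` C)) -
    fine (P (joint A S @^-1` (C `&` ordered_on_grid (mesh n) (ncells n))))| <=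
  K * 2^-1 ^+ n.
Proof.
have mu_gt0 := lt_trans lambda_gt0 lambda_lt_mu.
set rho := lambda / mu; set r := Num.sqrt rho.
have rho0 : 0 < rho by rewrite divr_gt0.
have rho1 : rho < 1 by rewrite ltr_pdivrMr ?mul1r.
have r0 : 0 <= r by rewrite sqrtr_ge0.
have rE : rho = r ^+ 2 by rewrite sqr_sqrtr// ltW.
have r1 : r < 1 by nra.
have lE : lambda = r ^+ 2 * mu by rewrite -rE /rho mulfVK// gt_eqF.
set kappa := lambda + mu - 2 * r * mu.
have kappa0 : 0 < kappa.
  rewrite (_ : kappa = mu * (1 - r) ^+ 2); last by rewrite /kappa lE; ring.
  by rewrite mulr_gt0// exprn_gt0// subr_gt0.
exists (2 * (lambda + mu) ^+ 2 + kappa^-1) => n C mC detC.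
apply: le_trans (grid_error lambda_gt0 lambda_lt_mu (mesh_gt0 n) A_poisson
  S_poisson AS_independent mC detC) _.
rewrite exprMn [_%:R * (_ * mesh n ^+ 2)]mulrCA ncells_mesh2 ncells_mesh -/rho.
rewrite -/r -/kappa [leRHS]mulrDl -[X in _ <= X + _]mulrA lerD2l.
rewrite expRN exprVn -invfM lef_pV2 ?posrE ?expR_gt0//; last first.
  by rewrite mulr_gt0// exprn_gt0.
have := expR_ge1Dx (kappa * 2 ^+ n); apply: le_trans; by rewrite lerDr.
Qed.

(** The grid orderings decrease to [ordered_paths], so their probabilities
    converge by continuity from above, and the error of the grid identity
    vanishes. *)
Lemma grid_event_identity C : grid_events C ->
  (1 - lambda / mu) * fine (P ((@Gamma2 R \o joint A S) @^-1` C)) =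
  fine (P (joint A S @^-1` (C `&` @ordered_paths R))).
Proof.
move=> [mC [m detC]]; have [K Kn] := grid_error_geometric.
set a := _ * _.
pose F n := C `&` ordered_on_grid (mesh n) (ncells n).
have mJ := @measurable_preimage_joint _ _ _ _ A S.
have mF n : measurable (F n).
  by apply: measurableI => //; exact: measurable_ordered_on_grid.
have FE : \bigcap_n F n = C `&` @ordered_paths R.
  by rewrite -bigcap_ordered_on_grid -bigcapIr//; exists 0%N.
have cvgPF : P (joint A S @^-1` F n) @[n --> \oo] -->
    P (joint A S @^-1` (C `&` @ordered_paths R)).
  rewrite -FE preimage_bigcap; apply: nonincreasing_cvg_mu => /=.
  - by rewrite (le_lt_trans (probability_le1 _ _)) ?ltry//; exact: mJ.
  - by move=> n; exact: mJ.
  - by rewrite -preimage_bigcap FE; apply/mJ/measurableI => //;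
      exact: measurable_ordered_paths.
  - move=> i j ij; apply/subsetPset => w [Cw ow]; split=> //.
    by have /subsetPset := @ordered_on_grid_nonincreasing R _ _ ij; exact.
have cvgF : fine (P (joint A S @^-1` F n)) @[n --> \oo] -->
    fine (P (joint A S @^-1` (C `&` @ordered_paths R))).
  by apply: fine_cvg; rewrite fineK// fin_num_measure//; apply/mJ/measurableI => //;
    exact: measurable_ordered_paths.
apply: cvg_unique cvgF => //.
have geo : K * 2^-1 ^+ n @[n --> \oo] --> (0 : R).
  by apply: cvg_geometric; rewrite ger0_norm ?invr_ge0// invf_lt1// ltr1n.
apply/cvgrPdist_le => e e0.
have /cvgrPdist_le/(_ e e0) := geo => geo_e.
near=> n; have mn : (m <= n)%N by near: n; exact: nbhs_infty_ge.
apply: le_trans (Kn n C mC (grid_determined_refine mn detC)) _.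
have : `|0 - K * 2^-1 ^+ n| <= e by near: n.
by rewrite sub0r normrN; apply: le_trans; exact: ler_norm.
Unshelve. all: by end_near. Qed.

(** Both sides are finite measures in [C] that agree on the pi-system
    [grid_events]. *)
Lemma event_identity C : measurable C ->
  ((1 - lambda / mu)%:E * P ((@Gamma2 R \o joint A S) @^-1` C) =
  P (joint A S @^-1` (C `&` @ordered_paths R)))%E.
Proof.
have mu_gt0 := lt_trans lambda_gt0 lambda_lt_mu.
have c0 : 0 <= 1 - lambda / mu by rewrite subr_ge0 ler_pdivrMr// mul1r ltW.
pose m1 := mscale (NngNum c0) (distribution P (@Gamma2 R \o joint A S)).
pose m2 := mrestr (distribution P (joint A S)) (@measurable_ordered_paths R).
move=> mC; apply: (@measure_unique _ _ _ grid_events (fun=> setT) _ _ _ _ m1 m2) => //.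
- exact: grid_events_generate.
- exact: grid_events_setI.
- by move=> _; exact: grid_events_setT.
- by rewrite bigcup_const//; exists 0%N.
- move=> B gB; rewrite /m1 /m2 /mscale /mrestr /distribution /pushforward/=.
  have mX := measurable_preimage_Gamma2 A S gB.1.
  have mY := measurable_preimage_joint A S
    (measurableI _ _ gB.1 (@measurable_ordered_paths R)).
  have := congr1 EFin (grid_event_identity gB); rewrite EFinM.
  by rewrite !fineK//; exact: fin_num_measure.
- move=> _; rewrite /m1/= /mscale/= /distribution /pushforward/=.
  by rewrite preimage_setT probability_setT mule1 ltry.
Qed.

End limit.

Unset Implicit Arguments.

Theorem theorem5 (d : measure_display) (T : measurableType d) (R : realType)
    (P : probability T R) (lambda mu : R) (A S : {RV P >-> D0 R})
    (lambda_gt0 : 0 < lambda) (lambda_lt_mu : lambda < mu)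
    (A_poisson : poisson_process P lambda A) (S_poisson : poisson_process P mu S)
    (AS_independent : independent_RV2 P A S) :
  forall B : set (D0 R * D0 R), measurable B ->
    cond_distribution P [set w | forall t, 0 <= t -> A w t <= S w t]
      (joint A S) B
    = distribution P (@Gamma2 R \o joint A S) B.
Proof.
move=> B mB; have mu_gt0 := lt_trans lambda_gt0 lambda_lt_mu.
have c_neq0 : 1 - lambda / mu != 0.
  by rewrite subr_eq0 eq_sym lt_eqF// ltr_pdivrMr// mul1r.
have ident := event_identity lambda_gt0 lambda_lt_mu A_poisson S_poisson
  AS_independent.
have PE : P [set w | forall t, 0 <= t -> A w t <= S w t] = (1 - lambda / mu)%:E.
  have := ident setT measurableT.
  by rewrite setTI preimage_setT probability_setT mule1 => ->.
rewrite /cond_distribution /pushforward /cond_prob PE/=.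
have := ident B mB; rewrite preimage_setI => <-.
by rewrite muleAC -EFinM mulfV// mul1e.
Qed.
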